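(* The independence polynomial of any centipede is log-concave; that is, for every $n\geq 1$, the polynomial $I(W_n;x)$ is log-concave, where $W_n=P_n^{\ast}$.
   Context: All graphs are finite, undirected, without loops or multiple edges. $P_n$ denotes the (chordless) path on $n\geq 1$ vertices. For a graph $G$, $G^{\ast}$ denotes the graph obtained from $G$ by appending a single pendant edge to each vertex of $G$, i.e. by adding, for each vertex $v$ of $G$, one new vertex joined only to $v$. The centipede $W_n$ is the tree $W_n=P_n^{\ast}$, $n\geq 1$ (so it has $2n$ vertices). A stable set in a graph $G$ is a set of pairwise non-adjacent vertices; the stability number $\alpha(G)$ is the maximum size of a stable set in $G$. Let $s_k$ be the number of stable sets of cardinality $k$ in $G$ (so $s_0=1$); the independence polynomial of $G$ is $I(G;x)=\sum_{k=0}^{\alpha(G)}s_kx^k$. A finite sequence of real numbers $(a_0,a_1,\dots,a_n)$ is log-concave if $a_i^2\geq a_{i-1}a_{i+1}$ for all $1\leq i\leq n-1$; a polynomial is log-concave if its sequence of coefficients is log-concave. *)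

(* Defs.v *)
From HB Require Import structures.
From mathcomp Require Import all_boot all_order all_algebra.

Set Implicit Arguments.
Unset Strict Implicit.
Unset Printing Implicit Defensive.

Import Order.TTheory GRing.Theory Num.Theory.

Record sgraph : Type := SGraph {
  vertex :> finType;
  adj : rel vertex;
  adj_sym : symmetric adj;
  adj_irrefl : irreflexive adj
}.

Definition path_adj (n : nat) : rel 'I_n :=
  fun i j => (i.+1 == j :> nat) || (j.+1 == i :> nat).

Lemma path_adj_sym n : symmetric (@path_adj n).
Proof. by move=> i j; rewrite /path_adj orbC. Qed.

Lemma path_adj_irrefl n : irreflexive (@path_adj n).
Proof. by move=> i; rewrite /path_adj orbb gtn_eqF. Qed.

Definition path_graph (n : nat) : sgraph :=
  SGraph (@path_adj_sym n) (@path_adj_irrefl n).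

(* In G^*, [inl v] is the original vertex v and [inr v] is the new vertex
   hanging from v. *)
Definition pendant_adj (G : sgraph) : rel (G + G)%type :=
  fun x y =>
    match x, y with
    | inl u, inl v => adj u v
    | inl u, inr v => u == v
    | inr u, inl v => u == v
    | inr _, inr _ => false
    end.

Lemma pendant_adj_sym (G : sgraph) : symmetric (@pendant_adj G).
Proof. by case=> u [] v //=; rewrite ?[u == v]eq_sym // adj_sym. Qed.

Lemma pendant_adj_irrefl (G : sgraph) : irreflexive (@pendant_adj G).
Proof. by case=> u //=; rewrite adj_irrefl. Qed.

Definition pendant_graph (G : sgraph) : sgraph :=
  SGraph (@pendant_adj_sym G) (@pendant_adj_irrefl G).

Definition centipede (n : nat) : sgraph := pendant_graph (path_graph n).

(* The case x = y is harmless, since [adj] is irreflexive. *)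
Definition stable (G : sgraph) (S : {set G}) : bool :=
  [forall x in S, forall y in S, ~~ adj x y].

Definition stability_number (G : sgraph) : nat :=
  \max_(S : {set G} | stable S) #|S|.

Definition num_stable (G : sgraph) (k : nat) : nat :=
  #|[set S : {set G} | stable S && (#|S| == k)]|.

Local Open Scope ring_scope.

Definition indep_poly (G : sgraph) : {poly int} :=
  \sum_(k < (stability_number G).+1) (num_stable G k)%:R *: 'X^k.

Definition log_concave (R : realDomainType) (a : seq R) : Prop :=
  forall i : nat, (0 < i)%N -> (i.+1 < size a)%N ->
    a`_i.-1 * a`_i.+1 <= a`_i ^+ 2.

(* The coefficient list [polyseq p] is (p`_0, ..., p`_(deg p)). *)
Definition log_concave_poly (R : realDomainType) (p : {poly R}) : Prop :=
  log_concave (polyseq p).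

(* Main.v *)
(* Deleting the last vertex of the spine, or taking it and thereby discarding its
   neighbour, gives c_{n+2} = (1 + X)(c_{n+1} + X c_n) for c_n = I(W_n; X).
   Dividing out the powers of 1 + X, one alternates the steps
   (g, f) -> (f, f + X g) and (g, f) -> (f, (1 + X) f + X g), starting from (1, 1).
   Log-concavity of f compares f with X f through 2 x 2 minors of coefficients;
   imposing these minor inequalities between f, g and all shifts X^k f, X^k g as
   well gives a condition that both steps preserve merely by bilinearity of the
   minors, and so does multiplication by 1 + X. *)
Require Import Defs.
From mathcomp Require Import all_boot all_order all_algebra.
From mathcomp Require Import ring.

Set Implicit Arguments.
Unset Strict Implicit.
Unset Printing Implicit Defensive.

Import Order.TTheory GRing.Theory Num.Theory.
Local Open Scope ring_scope.

(** * Minor inequalities between coefficient sequences *)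

Section CoefficientRatios.
Variable R : realDomainType.
Implicit Types p q r f g : {poly R}.

(* Where the ratios q_i / p_i make sense, this says that they increase with i;
   unlike that formulation, it is additive in p and in q. *)
Definition ratio_le p q : Prop :=
  forall i j : nat, (i <= j)%N -> q`_i * p`_j <= p`_i * q`_j.

(** For [q = p] this says that all 2 x 2 minors of the Toeplitz matrix of [p] are nonnegative;
    [k = 1] already yields log-concavity. *)
Definition shift_ratio_le p q : Prop :=
  forall k : nat, ratio_le p ('X^k * q).

Local Notation "p <~ q" := (shift_ratio_le p q) (at level 70).

Lemma ratio_leDl p q r : ratio_le p r -> ratio_le q r -> ratio_le (p + q) r.
Proof.
by move=> hp hq i j ij; rewrite !coefD mulrDl mulrDr lerD ?hp ?hq.
Qed.

Lemma ratio_leDr p q r : ratio_le r p -> ratio_le r q -> ratio_le r (p + q).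
Proof.
by move=> hp hq i j ij; rewrite !coefD mulrDl mulrDr lerD ?hp ?hq.
Qed.

Lemma ratio_leX p q : ratio_le p q -> ratio_le ('X * p) ('X * q).
Proof.
move=> h [|i] [|j] //= ij; rewrite !coefXM /= ?mul0r //.
exact: h.
Qed.

Lemma shift_ratio_leDl p q r : p <~ r -> q <~ r -> p + q <~ r.
Proof. by move=> hp hq k; apply: ratio_leDl. Qed.

Lemma shift_ratio_leDr p q r : r <~ p -> r <~ q -> r <~ p + q.
Proof. by move=> hp hq k; rewrite mulrDr; apply: ratio_leDr. Qed.

Lemma shift_ratio_leX p q : p <~ q -> 'X * p <~ 'X * q.
Proof. by move=> h k; rewrite mulrCA; apply: ratio_leX. Qed.

Lemma shift_ratio_leXr p q : p <~ q -> p <~ 'X * q.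
Proof. by move=> h k; rewrite mulrA -exprSr; apply: h. Qed.

(* For k >= 1 this is the hypothesis; for k = 0 the two minors coincide. *)
Lemma shift_ratio_le_refl p : p <~ 'X * p -> p <~ p.
Proof.
move=> h [|k]; first by rewrite mul1r.
by rewrite exprSr -mulrA; apply: h.
Qed.

Lemma shift_ratio_le1 : 1 <~ 1.
Proof.
move=> k i [|j]; first by rewrite leqn0 => /eqP ->; rewrite mulrC.
by rewrite mulr1 !coef1 !coefXn mulr0 -natrM ler0n.
Qed.

Lemma shift_ratio_le_log_concave p : p <~ p -> log_concave_poly p.
Proof.
move=> h [//|i] _ _; have := h 1%N i.+1 i.+2 (leqnSn _).
by rewrite !coefXM.
Qed.

Lemma shift_ratio_le_mul1X p : p <~ p -> (1 + 'X) * p <~ (1 + 'X) * p.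
Proof.
(* Direct expansion would ask for ['X * p <~ p], false in general; after the extra shift on the
   right, no term has more factors ['X] on its left than on its right. *)
move=> h; apply: shift_ratio_le_refl; rewrite mulrDl mul1r mulrDr.
by apply: shift_ratio_leDl; apply: shift_ratio_leDr;
   do ?[exact: h | apply: shift_ratio_leX | apply: shift_ratio_leXr].
Qed.

Lemma shift_ratio_le_exp1X p m :
  p <~ p -> (1 + 'X) ^+ m * p <~ (1 + 'X) ^+ m * p.
Proof.
move=> h; elim: m => [|m ih]; first by rewrite mul1r.
by rewrite exprS -mulrA; apply: shift_ratio_le_mul1X.
Qed.

(* Without the factor X in the third condition, equal shifts would be compared
   in both directions, forcing f and g to be proportional. *)
Definition coef_interlace g f : Prop :=
  [/\ g <~ g, g <~ f, f <~ 'X * g & f <~ f].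

Lemma coef_interlace1 : coef_interlace 1 1.
Proof.
by split; do ?apply: shift_ratio_leXr; apply: shift_ratio_le1.
Qed.

Ltac shift_tac :=
  do ?[assumption | apply: shift_ratio_leDl | apply: shift_ratio_leDr
      | apply: shift_ratio_leX | apply: shift_ratio_leXr].

Lemma coef_interlace_addX g f :
  coef_interlace g f -> coef_interlace f (f + 'X * g).
Proof.
(* Only the last condition, [f + 'X * g] against itself, takes the shifted route: expanded directly,
   it would need ['X * g <~ f]. *)
by case=> gg gf fg ff; split; try (apply: shift_ratio_le_refl; rewrite mulrDr);
   shift_tac.
Qed.

Lemma coef_interlace_mul1X_addX g f :
  coef_interlace g f -> coef_interlace f ((1 + 'X) * f + 'X * g).
Proof.
rewrite mulrDl mul1r; case=> gg gf fg ff.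
by split; try (apply: shift_ratio_le_refl; rewrite !mulrDr); shift_tac.
Qed.

(** Two steps of the recurrence release one new factor [1 + 'X]. Here [g] plays the role of c_{2m-1}
    / (1 + X)^(m-1). *)
Lemma centipede_rec_interlace (c : nat -> {poly R}) :
    c 0%N = 1 -> c 1%N = (1 + 'X) + 'X ->
    (forall n, c n.+2 = (1 + 'X) * (c n.+1 + 'X * c n)) ->
  forall m, exists g f,
    [/\ coef_interlace g f, c m.*2 = (1 + 'X) ^+ m * f
      & c m.*2.+1 = (1 + 'X) ^+ m * ((1 + 'X) * f + 'X * g)].
Proof.
move=> c0 c1 cS; elim=> [|m [g [f [gf cf cg]]]].
  (* Running the recurrence backwards gives c_{-1} = 1 / (1 + X), hence the initial [g] is 1. *)
  by exists 1, 1; split; [exact: coef_interlace1 | rewrite c0 mulr1 |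
    rewrite c1 mul1r !mulr1].
set h := (1 + 'X) * f + 'X * g in cg.
have fh : coef_interlace f h by apply: coef_interlace_mul1X_addX.
exists h, (h + 'X * f); split; first exact: coef_interlace_addX.
  by rewrite doubleS cS cf cg exprS; ring.
by rewrite doubleS !cS cf cg exprS; ring.
Qed.

Lemma centipede_rec_log_concave (c : nat -> {poly R}) :
    c 0%N = 1 -> c 1%N = (1 + 'X) + 'X ->
    (forall n, c n.+2 = (1 + 'X) * (c n.+1 + 'X * c n)) ->
  forall n, log_concave_poly (c n).
Proof.
move=> c0 c1 cS n; apply: shift_ratio_le_log_concave.
have [g [f [gf cf cg]]] := centipede_rec_interlace c0 c1 cS n./2.
rewrite -(odd_double_half n); case: (odd n); rewrite ?add0n ?add1n.
  rewrite cg; apply: shift_ratio_le_exp1X.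
  by have [] := coef_interlace_mul1X_addX gf.
by rewrite cf; apply: shift_ratio_le_exp1X; have [] := gf.
Qed.

End CoefficientRatios.

(** * The independence polynomial of a graph with pendant edges *)

Lemma sum_stable_indep_poly (G : sgraph) :
  indep_poly G = \sum_(S : {set G} | stable S) 'X^#|S|.
Proof.
have inordE (S : {set G}) :
    stable S -> (inord #|S| : 'I_(stability_number G).+1) = #|S| :> nat.
  by move=> hS; rewrite inordK // ltnS leq_bigmax_cond.
(* Stable sets are grouped by size; [inord] loses nothing, since these sizes are at most the
   stability number. *)
rewrite (partition_big (fun S : {set G} =>
  inord #|S| : 'I_(stability_number G).+1) xpredT) //=.
apply: eq_bigr => k _; rewrite /num_stable -sum1_card natr_sum scaler_suml.
rewrite [LHS](eq_bigl (fun S : {set G} => stable S && (inord #|S| == k))).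
  by apply: eq_bigr => S /andP[hS /eqP <-]; rewrite scale1r inordE.
move=> S; rewrite inE; case: (boolP (stable S)) => //= hS.
by rewrite -val_eqE /= inordE.
Qed.

(** A stable set is a stable core [T] together with any set of leaves not attached to [T]: a vertex
    of [T] gives ['X], while any other has a free leaf, giving [1 + 'X]. *)
Lemma indep_poly_pendant (G : sgraph) :
  indep_poly (pendant_graph G) =
  \sum_(T : {set G} | stable T) \prod_(v : G) (if v \in T then 'X else 1 + 'X).
Proof.
rewrite sum_stable_indep_poly.
pose core (S : {set pendant_graph G}) : {set G} := [set v | inl v \in S].
pose leaves (S : {set pendant_graph G}) : {set G} := [set v | inr v \in S].
pose glue (TU : {set G} * {set G}) : {set pendant_graph G} :=
  [set x | match x with inl v => v \in TU.1 | inr v => v \in TU.2 end].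
have glueK : cancel (fun S => (core S, leaves S)) glue.
  by move=> S; apply/setP => -[] v; rewrite !inE.
have Kglue : cancel glue (fun S => (core S, leaves S)).
  by case=> T U; congr (_, _); apply/setP => v; rewrite !inE.
have card_glue TU : #|glue TU| = (#|TU.1| + #|TU.2|)%N.
  rewrite -!sum1_card (big_sumType addn) /=.
  by congr addn; apply: eq_bigl => v; rewrite !inE.
have stable_glue TU : stable (glue TU) = stable TU.1 && [disjoint TU.2 & TU.1].
  apply/forall_inP/andP => [h|[/forall_inP sT dU]].
    split; last first.
      apply/pred0Pn => -[v /= /andP[vU vT]].
      have hv : inl v \in glue TU by rewrite inE.
      have := forall_inP (h _ hv) (inr v); rewrite inE => /(_ vU).
      by rewrite /= eqxx.
    apply/forall_inP => u uT; apply/forall_inP => v vT.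
    have hu : inl u \in glue TU by rewrite inE.
    by have := forall_inP (h _ hu) (inl v); rewrite inE => /(_ vT).
  have ne u v : u \in TU.1 -> v \in TU.2 -> u != v.
    move=> uT; apply: contraTneq => <-.
    by rewrite (disjointFl dU).
  case=> u; rewrite inE => hu; apply/forall_inP => -[] v; rewrite inE => hv //=.
  - exact: (forall_inP (sT _ hu)).
  - exact: ne.
  - by rewrite eq_sym ne.
rewrite (reindex glue) /=; last by exists (fun S => (core S, leaves S)) => ? _.
rewrite (eq_bigl _ _ stable_glue).
under eq_bigr do rewrite card_glue exprD.
rewrite -(pair_big_dep (@stable G) (fun T U : {set G} => [disjoint U & T])
            (fun T U : {set G} => 'X^#|T| * 'X^#|U| : {poly int})) /=.
apply: eq_bigr => T _; rewrite -big_distrr /= (bigID (mem T)) /=.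
rewrite [X in _ = X * _](eq_bigr (fun=> 'X : {poly int})); last by move=> v ->.
rewrite prodr_const; congr (_ * _).
(* When the product is expanded over leaf sets [U], the 0 kills every [U] meeting [T]. *)
transitivity (\prod_v ((if v \in T then 0 else 'X) + 1 : {poly int})).
  rewrite bigA_distr /= [RHS](bigID (fun U : {set G} => [disjoint U & T])) /=.
  rewrite [X in _ + X]big1 ?addr0 => [|U].
    apply: eq_bigr => U dU; rewrite (bigID (mem U)) /=.
    rewrite [X in _ * X]big1 ?mulr1 => [|v /negbTE -> //].
    rewrite (eq_bigr (fun=> 'X : {poly int})) ?prodr_const // => v vU.
    by rewrite vU (disjointFr dU).
  case/pred0Pn => v /= /andP[vU vT].
  by rewrite (bigD1 v) //= vU vT mul0r.
rewrite (bigID (mem T)) /= big1 ?mul1r => [|v ->]; last by rewrite add0r.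
by apply: eq_bigr => v /negbTE ->; rewrite addrC.
Qed.

(** * Stable sets of the path as Boolean words without two consecutive [true] *)

Lemma stable_path n (t : n.-tuple bool) :
  @stable (path_graph n) [set i | tnth t i] = sorted (fun a b => ~~ (a && b)) t.
Proof.
apply/forall_inP/(sortedP false) => [h i|h u].
  rewrite size_tuple => hi; have hi' := ltnW hi.
  apply/negP => /andP[ti tj].
  have hu : Ordinal hi' \in [set i | tnth t i].
    by rewrite inE (tnth_nth false).
  have := forall_inP (h _ hu) (Ordinal hi); rewrite inE (tnth_nth false) /=.
  by move=> /(_ tj); rewrite /path_adj eqxx.
rewrite inE (tnth_nth false) => tu; apply/forall_inP => v.
rewrite inE (tnth_nth false) => tv; apply/negP => /orP[] /eqP e.
  by have := h u; rewrite size_tuple e ltn_ord tu tv => /(_ isT).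
by have := h v; rewrite size_tuple e ltn_ord tu tv => /(_ isT).
Qed.

Lemma sum_tuple_cons (V : nmodType) (T : finType) n (P : pred (seq T))
    (F : seq T -> V) :
  \sum_(t : n.+1.-tuple T | P t) F t =
  \sum_(a : T) \sum_(t : n.-tuple T | P (a :: t)) F (a :: t).
Proof.
rewrite (reindex (fun at_ : T * n.-tuple T => cons_tuple at_.1 at_.2)) /=.
  by rewrite (pair_big_dep _ (fun a (t : n.-tuple T) => P (a :: t))
               (fun a (t : n.-tuple T) => F (a :: t))).
exists (fun t : n.+1.-tuple T => (thead t, behead_tuple t)) => [[a t]|t] _ /=.
  by congr (_, _); apply: val_inj.
by rewrite [RHS]tuple_eta.
Qed.

Section PathWeights.
Variables (R : comNzRingType) (w : bool -> R).

(* The boolean b stands for the vertex preceding the path: when it is true, the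
   first vertex of the path is excluded. *)
Definition sparse_sum (b : bool) (n : nat) : R :=
  \sum_(t : n.-tuple bool | path (fun a b => ~~ (a && b)) b t) \prod_(a <- t) w a.

Lemma sparse_sum0 b : sparse_sum b 0 = 1.
Proof.
rewrite /sparse_sum (big_pred1 [tuple]) ?big_nil // => t.
by rewrite [t]tuple0 /= eqxx.
Qed.

Lemma sparse_sumS b n :
  sparse_sum b n.+1 = (if b then 0 else w true * sparse_sum true n)
                      + w false * sparse_sum false n.
Proof.
rewrite /sparse_sum (sum_tuple_cons n (path _ b) (fun t => \prod_(a <- t) w a)).
rewrite big_bool /= !big_distrr /=.
congr (_ + _); last first.
  by apply: eq_big => [t|t _]; rewrite ?andbF // big_cons.
case: b => /=; first by rewrite big_pred0.
by apply: eq_bigr => t _; rewrite big_cons.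
Qed.

Lemma sum_stable_path n :
  \sum_(T : {set path_graph n} | stable T)
     \prod_(v : path_graph n) w (v \in T) = sparse_sum false n.
Proof.
pose toset (t : n.-tuple bool) : {set path_graph n} := [set i | tnth t i].
rewrite (reindex toset) /=.
  (* The start value [false] does not constrain the first letter, so [path] agrees with [sorted]. *)
  apply: eq_big => [t|t _]; first by rewrite stable_path; case: t => -[].
  by rewrite big_tuple; apply: eq_bigr => i _; rewrite inE.
exists (fun T : {set 'I_n} => [tuple i \in T | i < n]) => [t|T] _.
  by apply: eq_from_tnth => i; rewrite tnth_mktuple inE.
by apply/setP => i; rewrite inE tnth_mktuple.
Qed.

End PathWeights.

Theorem theorem7 (n : nat) (hn : (0 < n)%N) :
  log_concave_poly (indep_poly (centipede n)).
Proof.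
pose w (b : bool) : {poly int} := if b then 'X else 1 + 'X.
have -> : indep_poly (centipede n) = sparse_sum w false n.
  by rewrite indep_poly_pendant -sum_stable_path.
apply: (centipede_rec_log_concave (c := sparse_sum w false)) => [||m].
- exact: sparse_sum0.
- by rewrite sparse_sumS !sparse_sum0 !mulr1 addrC.
(* Taking the first vertex forces the second out; the latter contributes [1 + 'X] and leaves the
   rest of the path unconstrained. *)
- by rewrite sparse_sumS [sparse_sum _ true _]sparse_sumS /=; ring.
Qed.
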